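(* Let $\mu$ be a partition of $n$ and $\alpha$ a composition of $n$. For each Mahonian statistic $\varphi$, $$\tilde b_{\mu\alpha}(q,t)=\sum_{\mathcal{A}\in\Pi(\mu',\alpha)}q^{i_\alpha(\mathcal{A})}\,t^{\varphi_\alpha(\mathcal{A})}.$$ In particular, $$b_{\mu\alpha}(q)=\sum_{\mathcal{A}\in\Pi(\mu',\alpha)}q^{i_\alpha(\mathcal{A})+\varphi_\alpha(\mathcal{A})}.$$
   Context: $q,t$ are formal variables; $[n]_q=1+q+\cdots+q^{n-1}$, $[n]_q!=\prod_{i=1}^n[i]_q$, ${n\brack \beta_1,\beta_2,\ldots}_q=[n]_q!/\prod_j[\beta_j]_q!$. $\mu'$ is the conjugate partition of $\mu$. A composition is a finite sequence of positive integers. Canonical set partition: for a composition $\alpha=(\alpha_1,\ldots,\alpha_k)$ of $n$, $\mathcal{A}_\alpha$ is the set partition of $[n]=\{1,\dots,n\}$ with blocks $A_i=\{\alpha_1+\cdots+\alpha_{i-1}+1,\ldots,\alpha_1+\cdots+\alpha_i\}$, $1\le i\le k$. The shape of a set partition is the integer partition formed by its block sizes. $\Pi(\lambda,\alpha)$ is the set of set partitions $\mathcal{A}$ of $[n]$ of shape $\lambda$ such that each block of $\mathcal{A}$ meets each block of $\mathcal{A}_\alpha$ in at most one element. Mahonian statistics: for a weak composition $\beta=(\beta_1,\ldots,\beta_r)$ of $N$, $R(\beta)$ is the set of all words that are rearrangements of $1^{\beta_1}2^{\beta_2}\cdots r^{\beta_r}$. A Mahonian statistic $\varphi$ is a nonnegative-integer-valued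 function on words in the positive integers with $\sum_{w\in R(\beta)}q^{\varphi(w)}={N\brack\beta_1,\ldots,\beta_r}_q$ for every such $\beta$. For a word $w$ of length $n$, write $w=w_1w_2\cdots w_k$ as a concatenation with $w_i$ of length $\alpha_i$, and set $\varphi_\alpha(w)=\sum_{i=1}^k\varphi(w_i)$. For a set partition $\mathcal{A}$ of $[n]$, $w(\mathcal{A})=a_1\cdots a_n$ where $a_i=j$ if $i$ is the $j$-th smallest element of its block in $\mathcal{A}$; $\varphi_\alpha(\mathcal{A})=\varphi_\alpha(w(\mathcal{A}))$. $\alpha$-interlacings: to each block $\{b_1<\cdots<b_r\}$ of $\mathcal{A}$ associate arcs $(b_1,b_2),(b_2,b_3),\ldots,(b_r,b_{r+1})$ with $b_{r+1}=\infty$ (greater than all integers); $(b_j,b_{j+1})$ is the $j$-th arc of the block. An $\alpha$-interlacing of $\mathcal{A}$ is a pair of arcs $(a,b),(c,d)$ which are $j$-th arcs (same $j$) of two distinct blocks of $\mathcal{A}$, with $a<c<b<d$, and such that $b$ and $c$ do not belong to the same block of $\mathcal{A}_\alpha$. $i_\alpha(\mathcal{A})$ is the number of $\alpha$-interlacings of $\mathcal{A}$. Polynomials: $\tilde b_{\mu\alpha}(q,t)=\sum_{T\in\mathrm{SSYT}(\mu,\alpha)}r_q(T)s_t(T)$ and $b_{\mu\alpha}(q)=\tilde b_{\mu\alpha}(q,q)$, where $\mathrm{SSYT}(\mu,\alpha)$ is the set of semistandard tableaux of shape $\mu$ and content $\alpha$ (entry $i$ appears $\alpha_i$ times, rows weakly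 and columns strictly increasing). If $b_{ij}$ is the entry of $T$ in row $i$, column $j$, then for each cell with $i\ge2$, $r_{ij}(T)=\#\{j':j'\ge j,\ b_{i-1,j'}<b_{ij}\}$, and $r_q(T)=\prod_{(i,j):\,i\ge2}[r_{ij}(T)]_q$ over cells of $T$. If $\beta^i_j$ is the number of entries $i$ in row $j$ of $T$, then $s_t(T)=\prod_{i\ge1}{\alpha_i\brack\beta^i_1,\beta^i_2,\ldots}_t$. *)

(* Defs.v *)
From mathcomp Require Import all_boot all_order all_algebra.

Set Implicit Arguments.
Unset Strict Implicit.
Unset Printing Implicit Defensive.

Import GRing.Theory.

(* Indices are shifted down by one throughout: the set [n] = {1, ..., n} is
   'I_n, rows and columns of tableaux start at 0, and the entries of a tableau
   of content alpha are in 'I_(size alpha).  Letters of words (seq nat) are not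
   shifted: they are positive integers. *)

(** * Partitions and compositions *)

Definition is_partition_of (n : nat) (mu : seq nat) : bool :=
  [&& sorted geq mu, all (fun m => 0 < m) mu & sumn mu == n].

Definition is_composition_of (n : nat) (alpha : seq nat) : bool :=
  all (fun m => 0 < m) alpha && (sumn alpha == n).

(* head 0 mu is the largest part of mu. *)
Definition conj_part (mu : seq nat) : seq nat :=
  [seq count (fun m => j < m) mu | j <- iota 0 (head 0 mu)].

(** * q-analogues *)

Definition qint (n : nat) : {poly int} := (\sum_(i < n) 'X^i)%R.

Definition qfact (n : nat) : {poly int} := (\prod_(1 <= i < n.+1) qint i)%R.

(* The divisor is monic, hence %/ is Euclidean division over int; it is exact
   when sumn b = n. *)
Definition qmultinomial (n : nat) (b : seq nat) : {poly int} :=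
  (qfact n %/ \prod_(k <- b) qfact k)%R.

(** * Mahonian statistics *)

(* 1^(b_1) 2^(b_2) ... r^(b_r) *)
Definition base_word (b : seq nat) : seq nat :=
  flatten [seq nseq (nth 0 b i) i.+1 | i <- iota 0 (size b)].

(* A sequence b : seq nat is exactly a weak composition, and permutations lists
   the distinct rearrangements of a word without repetition. *)
Definition mahonian (phi : seq nat -> nat) : Prop :=
  forall b : seq nat,
    (\sum_(w <- permutations (base_word b)) 'X^(phi w) =
       qmultinomial (sumn b) b)%R.

Definition stat_word (alpha : seq nat) (phi : seq nat -> nat) (w : seq nat) :
    nat :=
  \sum_(u <- reshape alpha w) phi u.

(** * Set partitions *)

Section SetPartitions.

Variable n : nat.

Implicit Types (A : {set {set 'I_n}}) (B C : {set 'I_n}) (alpha : seq nat).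

Definition canonical_block alpha (i : nat) : {set 'I_n} :=
  [set x : 'I_n | sumn (take i alpha) <= x < sumn (take i.+1 alpha)].

Definition canonical alpha : {set {set 'I_n}} :=
  [set canonical_block alpha i | i : 'I_(size alpha)].

Definition shape_of A : seq nat := sort geq [seq #|B : {set 'I_n}| | B <- enum A].

Definition set_partitions (lambda alpha : seq nat) : {set {set {set 'I_n}}} :=
  [set A : {set {set 'I_n}} |
    [&& partition A [set: 'I_n], shape_of A == lambda
      & [forall B in A, forall C in canonical alpha, #|B :&: C| <= 1]]].

Definition word_of A : seq nat :=
  [seq #|[set y in pblock A x | y <= x]| | x <- enum 'I_n].

Definition stat alpha (phi : seq nat -> nat) A : nat :=
  stat_word alpha phi (word_of A).

(** * Interlacings *)

(* The second component None stands for infinity. *)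
Definition arc : Type := ('I_n * option 'I_n)%type.

(* enum B lists b_1 < ... < b_r in increasing order. *)
Definition arcs B : seq arc :=
  zip (enum B) (rcons [seq Some b | b <- behead (enum B)] None).

Definition lt_infty (x y : option 'I_n) : bool :=
  match x, y with
  | Some a, Some b => a < b
  | Some _, None => true
  | None, _ => false
  end.

Definition same_canonical_block alpha (x y : option 'I_n) : bool :=
  match x, y with
  | Some a, Some b => [exists D in canonical alpha, (a \in D) && (b \in D)]
  | _, _ => false
  end.

Definition interlacing alpha A (e f : arc) : bool :=
  [&& [exists B in A, exists C in A, exists j : 'I_n,
        [&& B != C, onth (arcs B) j == Some e & onth (arcs C) j == Some f]],
      lt_infty (Some e.1) (Some f.1), lt_infty (Some f.1) e.2,
      lt_infty e.2 f.2
    & ~~ same_canonical_block alpha e.2 (Some f.1)].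

Definition num_interlacings alpha A : nat :=
  #|[set p : ('I_n * option 'I_n) * ('I_n * option 'I_n) |
      interlacing alpha A p.1 p.2]|.

End SetPartitions.

(** * Semistandard tableaux and the polynomials *)

Section Tableaux.

Variables mu alpha : seq nat.

Definition cell : finType := {i : 'I_(size mu) & 'I_(nth 0 mu i)}.
Definition row_of (c : cell) : nat := tag c.
Definition col_of (c : cell) : nat := tagged c.

Definition filling : finType := {ffun cell -> 'I_(size alpha)}.

Definition is_ssyt (T : filling) : bool :=
  [&& [forall c : cell, forall d : cell,
         (row_of c == row_of d) && (col_of c <= col_of d) ==> (T c <= T d)],
      [forall c : cell, forall d : cell,
         (col_of c == col_of d) && (row_of c < row_of d) ==> (T c < T d)]
    & [forall i : 'I_(size alpha), #|[set c | T c == i]| == nth 0 alpha i]].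

Definition SSYT : {set filling} := [set T | is_ssyt T].

Definition r_entry (T : filling) (c : cell) : nat :=
  #|[set d : cell | [&& (row_of d).+1 == row_of c, col_of c <= col_of d
                       & T d < T c]]|.

Definition r_weight (T : filling) : {poly int} :=
  (\prod_(c : cell | (0 < row_of c)%N) qint (r_entry T c))%R.

Definition row_count (T : filling) (i : 'I_(size alpha)) (j : nat) : nat :=
  #|[set c | (T c == i) && (row_of c == j)]|.

Definition s_weight (T : filling) : {poly int} :=
  (\prod_(i < size alpha)
     qmultinomial (nth 0%N alpha i)
       [seq row_count T i j | j <- iota 0 (size mu)])%R.

(* In {poly {poly int}} the inner variable is q and the outer one is t: p%:P is
   p(q) and p^:P is p(t). *)
Definition b_tilde : {poly {poly int}} :=
  (\sum_(T in SSYT) (r_weight T)%:P * (s_weight T)^:P)%R.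

(* t is evaluated at q. *)
Definition b_poly : {poly int} := (b_tilde.['X])%R.

End Tableaux.

(* Main.v *)
Require Import Defs.
From mathcomp Require Import all_boot all_order all_algebra.
From mathcomp Require Import zify.

(* The word [word_of A] records the position of every element in its block.  For
   a fixed word, A amounts to choosing for each non-minimal x its predecessor:
   an element of an earlier canonical block, whose letter is one less, and which
   is not already the predecessor of some y < x.  If a chosen predecessor is the
   (k+1)-st largest candidate, then x closes exactly k interlacings, so choosing
   the predecessors of x = 0, 1, ... in turn gives a product of q-integers which
   depends only on how many times each letter occurs in each canonical block.
   Reading the canonical blocks of the occurrences of each letter from left to
   right fills the corresponding row of a tableau T, and the product is the
   r-weight of T if T is column-strict and 0 otherwise.  The words with tableau T
   are the concatenations of arbitrary rearrangements of prescribed multisets,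
   one for each canonical block, so a Mahonian statistic sums to the s-weight. *)

Set Implicit Arguments.
Unset Strict Implicit.
Unset Printing Implicit Defensive.

Import GRing.Theory.

(** * Sequential choice of predecessors *)

Lemma qintS n : qint n.+1 = (qint n + 'X^n)%R.
Proof. by rewrite /qint big_ord_recr. Qed.

(** The exponents, which rank [S] from the top, take each value below [#|S|] once. The induction
    removes the minimum of [S], which has the largest exponent and does not affect the others. *)
Lemma sum_rank_qint n (S : {set 'I_n}) :
  (\sum_(v in S) 'X^(#|[set c in S | (v < c)%N]|) = qint #|S|)%R.
Proof.
elim: {S}#|S| {-2}S (erefl #|S|) => [|k IHk] S cardS.
  by move/eqP: cardS; rewrite cards_eq0 => /eqP->; rewrite big_set0 cards0 /qint big_ord0.
have /card_gt0P[x0 x0S] : 0 < #|S| by rewrite cardS.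
case: (arg_minnP (@nat_of_ord n) x0S) => m mS minm.
have {}mS : m \in S by [].
have {}minm v : v \in S -> m <= v by exact: minm.
have cardD : #|S :\ m| = k by have := cardsD1 m S; rewrite mS cardS => -[].
rewrite (big_setD1 m) //= cardS qintS addrC; congr (_ + _)%R.
  rewrite -cardD -(IHk _ cardD); apply: eq_bigr => v; rewrite !inE => /andP[vm vS].
  congr ('X^ _)%R; apply: eq_card => c; rewrite !inE.
  case: eqP => //= ->; apply/negbTE; rewrite negb_and -leqNgt minm ?orbT //.
congr ('X^ _)%R; rewrite -cardD; apply: eq_card => c; rewrite !inE.
rewrite andbC; case cS: (c \in S); rewrite ?andbF // !andbT.
by rewrite ltn_neqAle minm // andbT eq_sym.
Qed.

Section Chains.

Variables (n : nat) (cb w : 'I_n -> nat).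
Hypothesis cb_mono : {homo cb : x y / x <= y}.

Implicit Types (f g : {ffun 'I_n -> 'I_n}) (x y z v : 'I_n).

(** The candidates left for the predecessor of [x]. Here [cb] stands for the index of the canonical
    block, and [w] for the letters counted from 0, so [0 < w y] says that [y] is not the minimum of
    its block. *)
Definition avail f x : {set 'I_n} :=
  [set c | [&& (w c).+1 == w x, cb c < cb x
             & [forall y : 'I_n, (y < x) && (0 < w y) ==> (f y != c)]]].

Definition valid_at f x : bool :=
  if 0 < w x then f x \in avail f x else f x == x.

(** A partial run of the choices: [f] is frozen to the identity from [m] on, so that distinct maps
    correspond to distinct choices below [m]. *)
Definition valid_upto m f : bool :=
  [forall x : 'I_n, if x < m then valid_at f x else f x == x].

Definition choice_rank f x : nat := #|[set c in avail f x | f x < c]|.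

(** The subtraction is truncated: the value is 0 as soon as the earlier elements with the letter of
    [x] are at least as many as the candidates. This makes the product vanish when column-strictness
    fails. *)
Definition num_choices x : nat :=
  #|[set c | ((w c).+1 == w x) && (cb c < cb x)]|
    - #|[set y : 'I_n | (y < x) && (w y == w x)]|.

(** The earlier elements with the letter of [x] have used up pairwise distinct candidates, and since
    [cb] is monotone each of these is also a candidate for [x]. Hence the number left does not
    depend on [f]. *)
Lemma card_avail f x :
  0 < w x -> (forall y, y < x -> valid_at f y) -> #|avail f x| = num_choices x.
Proof.
move=> wx fx.
pose P := [set c | ((w c).+1 == w x) && (cb c < cb x)].
pose Y := [set y : 'I_n | (y < x) && (w y == w x)].
have YP y : y \in Y -> [/\ y < x, w y = w x & f y \in avail f y].
  rewrite inE => /andP[yx /eqP wy]; split=> //.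
  by have := fx y yx; rewrite /valid_at wy wx.
have -> : avail f x = P :\: f @: Y.
  apply/setP => c; rewrite !inE [RHS]andbC -andbA.
  case: eqP => //= wc; case: ltnP => //= cbc; apply/forallP/negP.
    move=> H /imsetP[y yY cE]; have [yx wy _] := YP y yY.
    by have := H y; rewrite yx wy wx -cE eqxx.
  move=> H y; apply/implyP => /andP[yx wy]; apply/eqP => fy; case: H; apply/imsetP.
  exists y => //; rewrite inE yx /=.
  have := fx y yx; rewrite /valid_at wy inE => /and3P[/eqP<- _ _].
  by rewrite fy wc.
rewrite cardsD; congr (_ - _).
rewrite (setIidPr _).
  (* If two of them had the same image, the later one would have chosen an element already taken. *)
  apply: card_in_imset => y z /YP[yx wy fy] /YP[zx wz fz] fyz.
  apply/val_inj/eqP; rewrite /= eqn_leq; apply/andP; split; rewrite leqNgt; apply/negP => lt.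
    move: fy; rewrite inE => /and3P[_ _ /forallP/(_ z)].
    by rewrite lt wz wx fyz eqxx.
  move: fz; rewrite inE => /and3P[_ _ /forallP/(_ y)].
  by rewrite lt wy wx fyz eqxx.
apply/subsetP => c /imsetP[y /YP[yx wy]]; rewrite inE => /and3P[/eqP wfy cbf _] ->.
by rewrite inE wfy wy eqxx (leq_trans cbf) // cb_mono // ltnW.
Qed.

Definition upd f z v : {ffun 'I_n -> 'I_n} := [ffun x => if x == z then v else f x].

Lemma avail_upd f z v x : x <= z -> avail (upd f z v) x = avail f x.
Proof.
move=> xz; apply/setP => c; rewrite !inE; congr [&& _, _ & _].
apply: eq_forallb => y; case: ltnP => //= yx; rewrite ffunE.
by case: (y =P z) yx => // ->; rewrite ltnNge xz.
Qed.

Lemma valid_at_upd f z v x : x < z -> valid_at (upd f z v) x = valid_at f x.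
Proof.
move=> xz; rewrite /valid_at (avail_upd _ _ (ltnW xz)) ffunE.
by case: (x =P z) xz => // ->; rewrite ltnn.
Qed.

Lemma choice_rank_upd f z v x :
  x < z -> choice_rank (upd f z v) x = choice_rank f x.
Proof.
move=> xz; rewrite /choice_rank (avail_upd _ _ (ltnW xz)) ffunE.
by case: (x =P z) xz => // ->; rewrite ltnn.
Qed.

Lemma valid_uptoS f z v : valid_upto z f ->
  valid_upto z.+1 (upd f z v) = (if 0 < w z then v \in avail f z else v == z).
Proof.
move=> /forallP fz; apply/forallP/idP => [/(_ z)|Hv x].
  by rewrite ltnSn /valid_at avail_upd // ffunE eqxx.
have := fz x; rewrite ltnS (leq_eqVlt x) val_eqE.
have [->|xz] := eqVneq x z => /=.
  by rewrite /valid_at avail_upd // ffunE eqxx.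
case: ltnP => zx; first by rewrite valid_at_upd.
by rewrite ffunE (negbTE xz).
Qed.

(** Induction on [m]: whatever the earlier choices were, the ranks of the possible choices at the
    next element run through 0, 1, ..., [num_choices] minus one, so its sum factors out as a
    q-integer. *)
Lemma sum_valid_upto m : m <= n ->
  (\sum_(f | valid_upto m f) \prod_(x : 'I_n | (x < m)%N && (0 < w x)%N) 'X^(choice_rank f x)
     = \prod_(x : 'I_n | (x < m)%N && (0 < w x)%N) qint (num_choices x))%R.
Proof.
elim: m => [|m IHm] mn.
  rewrite (big_pred1 [ffun x => x]) => [|f]; first by rewrite !big_pred0.
  apply/forallP/eqP => [fid|-> x]; last by rewrite ffunE.
  by apply/ffunP => x; rewrite ffunE; apply/eqP/fid.
pose z := Ordinal mn.
have splitz (F : 'I_n -> {poly int}) :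
    (\prod_(x : 'I_n | (x < m.+1)%N && (0 < w x)%N) F x =
      (if (0 < w z)%N then F z else 1) *
       \prod_(x : 'I_n | (x < m)%N && (0 < w x)%N) F x)%R.
  rewrite big_mkcond (bigD1 z) //= leqnn /=.
  congr (_ * _)%R.
  rewrite [RHS]big_mkcond [RHS](bigD1 z) //= ltnn mul1r; apply: eq_bigr => x xz.
  by rewrite ltnS (leq_eqVlt x) -[m]/(val z) val_eqE (negbTE xz).
rewrite splitz -(IHm (ltnW mn)).
rewrite mulr_sumr.
(* Maps are grouped by what remains after the choice at [z] is forgotten; each fibre is then
   parametrized by the value at [z]. *)
rewrite (partition_big (fun f => upd f z z) (valid_upto m)) /=; last first.
  move=> f /forallP fm; apply/forallP => x; have := fm x.
  rewrite ltnS (leq_eqVlt x) -[m]/(val z) val_eqE.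
  have [->|xz] := eqVneq x z => /=; first by rewrite ltnn ffunE eqxx.
  by case: ltnP => xm; rewrite ?valid_at_upd // ffunE (negbTE xz).
apply: eq_bigr => g gm.
have gz : upd g z z = g.
  apply/ffunP => x; rewrite ffunE; case: eqP => // ->.
  by have /forallP/(_ z) := gm; rewrite ltnn => /eqP.
have uu v v' : upd (upd g z v) z v' = upd g z v'.
  by apply/ffunP => x; rewrite !ffunE; case: eqP.
rewrite (reindex_onto (upd g z) (fun f => f z)) /=; last first.
  move=> f /andP[_ /eqP <-]; apply/ffunP => x; rewrite !ffunE.
  by case: eqP => // ->.
have gS v : valid_upto m.+1 (upd g z v) = (if 0 < w z then v \in avail g z else v == z).
  exact: (@valid_uptoS g z).
under eq_bigl => v do rewrite uu gz eqxx ffunE eqxx eqxx !andbT gS.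
under eq_bigr => v _.
  rewrite splitz; under eq_bigr => x /andP[xm _] do rewrite choice_rank_upd //.
  over.
rewrite -big_distrl /=; congr (_ * _)%R.
case: ifP => wz; last by rewrite big_pred1_eq.
rewrite -(@card_avail g) ?sum_rank_qint // => [|y yz]; last first.
  by have /forallP/(_ y) := gm; rewrite yz.
rewrite -sum_rank_qint; apply: eq_bigr => v _.
by rewrite /choice_rank avail_upd // ffunE eqxx.
Qed.

End Chains.

(** * Set partitions with a given word *)

Lemma count_ltn_sorted (s : seq nat) j :
  sorted ltn s -> j < size s -> count (fun y => y < nth 0 s j) s = j.
Proof.
elim: s j => // x s IHs [|j] /= xs js.
  rewrite ltnn; apply/eqP; rewrite -leqn0 leqNgt -has_count.
  apply/hasPn => y ys; have /allP/(_ y ys) := order_path_min ltn_trans xs.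
  by rewrite -leqNgt => /ltnW.
rewrite IHs ?(path_sorted xs) //.
by have /allP/(_ _ (mem_nth 0 js)) := order_path_min ltn_trans xs => /= ->.
Qed.

Lemma sorted_enum_ord n (B : {set 'I_n}) : sorted ltn (map val (enum B)).
Proof.
rewrite /enum_mem sorted_map; apply: sorted_filter.
  by move=> y x z; apply: ltn_trans.
by rewrite -sorted_map -enumT val_enum_ord iota_ltn_sorted.
Qed.

(** Positions in the sorted enumeration of a block are traded for numbers of smaller elements, so
    that arcs can be handled without lists. *)
Lemma onth_enum n (B : {set 'I_n}) j x :
  (onth (enum B) j == Some x) = (x \in B) && (#|[set y in B | y < x]| == j).
Proof.
have cardE_lt z : #|[set y in B | y < z]| = count (fun y => y < z) (map val (enum B)).
  rewrite count_map -sum1_card -sum1_count big_enum_cond /=.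
  by apply: eq_bigl => y; rewrite inE.
have sz : size (enum B) = size (map val (enum B)) by rewrite size_map.
apply/eqP/andP => [e|[xB /eqP <-]].
  have je : j < size (enum B) by rewrite -onthTE e.
  have xE := onth_nth x _ _ _ e.
  split; first by rewrite -mem_enum -xE mem_nth.
  rewrite cardE_lt -[X in _ == X](count_ltn_sorted (sorted_enum_ord B) (j := j)) -?sz //.
  by rewrite (nth_map x) // xE.
have xe : x \in enum B by rewrite mem_enum.
rewrite cardE_lt -{1}(nth_index x xe) -(nth_map x 0 val) ?index_mem //.
rewrite count_ltn_sorted ?sorted_enum_ord -?sz ?index_mem //.
by rewrite onthE (nth_map x) ?index_mem // nth_index.
Qed.

Lemma onth_arcs n (B : {set 'I_n}) j :
  onth (arcs B) j = omap (fun a => (a, onth (enum B) j.+1)) (onth (enum B) j).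
Proof.
rewrite /arcs; elim: (enum B) j => [|x s IHs] j; first by rewrite !onth0n.
by case: s IHs => [|y s] IHs; case: j => [|j] //=; rewrite ?onth0n // IHs.
Qed.

(** * Ranks, predecessors and successors inside the blocks of a set partition *)

Section SetPartition.

Variables (n : nat) (A : {set {set 'I_n}}).
Hypothesis partA : partition A [set: 'I_n].

(** Counted from 0, hence one less than the letter of [x] in [word_of A]. *)
Definition rank (x : 'I_n) : nat := #|[set y in pblock A x | y < x]|.

(** The right end of the arc that starts at [x], with [None] for infinity. *)
Definition succ (x : 'I_n) : option 'I_n := onth (enum (pblock A x)) (rank x).+1.

(** The minimum of a block is sent to itself, in agreement with the convention of [valid_at]. *)
Definition pred_map : {ffun 'I_n -> 'I_n} :=
  [ffun x => odflt x [pick y in pblock A x | (rank y).+1 == rank x]].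

Lemma mem_own_pblock x : x \in pblock A x.
Proof. by rewrite mem_pblock (cover_partition partA) inE. Qed.

Lemma pblock_eq x y : y \in pblock A x -> pblock A y = pblock A x.
Proof. by apply: same_pblock; case/and3P: partA. Qed.

Lemma pblock_sym x y : (y \in pblock A x) = (x \in pblock A y).
Proof. by apply/idP/idP => /pblock_eq ->; rewrite mem_own_pblock. Qed.

Lemma pblock_in x : pblock A x \in A.
Proof. by rewrite pblock_mem // (cover_partition partA) inE. Qed.

Lemma rank_ltn x y : y \in pblock A x -> (rank y < rank x) = (y < x).
Proof.
have ltn_rank u v : v \in pblock A u -> v < u -> rank v < rank u.
  move=> vu lt; apply/proper_card/properP; rewrite (pblock_eq vu); split.
    by apply/subsetP => z; rewrite !inE => /andP[-> /ltn_trans->].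
  by exists v; rewrite !inE vu ?ltnn ?andbF.
move=> yx; case: (ltngtP y x) => [lt|xy|e]; first exact: ltn_rank.
  by apply/negbTE; rewrite -leqNgt ltnW // ltn_rank // -pblock_sym.
by rewrite (val_inj e) ltnn.
Qed.

Lemma rank_inj x y : y \in pblock A x -> rank y = rank x -> y = x.
Proof.
move=> yx e; apply/val_inj; case: (ltngtP y x) => // lt.
  by have := rank_ltn yx; rewrite lt e ltnn.
by have := @rank_ltn y x; rewrite -pblock_sym lt e ltnn => /(_ yx).
Qed.

Lemma rank_pred x k : rank x = k.+1 -> exists2 y, y \in pblock A x & rank y = k.
Proof.
move=> rx; have /card_gt0P[y0 y0P] : 0 < rank x by rewrite rx.
(* The element sought is the largest one below [x] in its block. *)
case: (arg_maxnP (@nat_of_ord n) y0P) => y yP maxy.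
have {}yP : y \in [set z in pblock A x | z < x] by exact: yP.
have {}maxy z : z \in [set z in pblock A x | z < x] -> z <= y by exact: maxy.
move: (yP); rewrite inE => /andP[yx ltyx]; exists y => //.
have := cardsD1 y [set z in pblock A x | z < x]; rewrite -/(rank x) rx yP add1n => -[->].
apply: eq_card => z; rewrite !inE (pblock_eq yx).
case zx: (z \in pblock A x); rewrite ?andbF //=.
case: (ltngtP z y) => [lt||/val_inj->]; last by rewrite eqxx.
  by rewrite (ltn_trans lt ltyx) andbT; apply/esym/eqP => e; rewrite e ltnn in lt.
move=> yz; apply/esym/negbTE; rewrite negb_and; apply/orP; right.
by apply/negP => zltx; have := maxy z; rewrite inE zx zltx => /(_ isT); rewrite leqNgt yz.
Qed.

Lemma pred_mapP x : 0 < rank x ->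
  pred_map x \in pblock A x /\ (rank (pred_map x)).+1 = rank x.
Proof.
case rx: (rank x) => [//|k] _; rewrite ffunE; case: pickP => [y /andP[yx /eqP]|no] /=.
  by rewrite rx.
have [y yx ry] := rank_pred rx.
by have := no y; rewrite yx ry rx eqxx.
Qed.

Lemma pred_map0 x : rank x = 0 -> pred_map x = x.
Proof. by move=> rx; rewrite ffunE rx; case: pickP => //= y; rewrite andbF. Qed.

Lemma succP x y : (succ x == Some y) = (y \in pblock A x) && (rank y == (rank x).+1).
Proof.
rewrite /succ onth_enum; case yx: (y \in pblock A x) => //=.
by rewrite -{1}(pblock_eq yx).
Qed.

Lemma succ_pred x y : (succ x == Some y) = (0 < rank y) && (pred_map y == x).
Proof.
rewrite succP; apply/andP/andP => [[yx /eqP ry]|[/pred_mapP[py rpy] /eqP <-]].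
  have ry0 : 0 < rank y by rewrite ry.
  have [py rpy] := pred_mapP ry0; split=> //; apply/eqP/rank_inj.
    by rewrite -(pblock_eq yx).
  by move: rpy; rewrite ry => -[].
by rewrite pblock_sym py -rpy.
Qed.

Lemma arcsP B j e : B \in A ->
  (onth (arcs B) j == Some e)
    = [&& e.1 \in B, rank e.1 == j & e.2 == succ e.1].
Proof.
move=> BA; have tiA : trivIset A by case/and3P: partA.
case: e => a b /=; rewrite onth_arcs.
have -> : (a \in B) && ((rank a == j) && (b == succ a)) =
          (onth (enum B) j == Some a) && (b == succ a).
  rewrite onth_enum andbA; case aB: (a \in B) => //=.
  by rewrite /rank (def_pblock tiA BA aB).
case e: (onth (enum B) j) => [a'|] //=.
have /andP[a'B /eqP ra'] : (a' \in B) && (#|[set y in B | y < a']| == j).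
  by rewrite -onth_enum e.
rewrite -[Some (a', _) == _]/((a', _) == (a, b)) xpair_eqE -[Some a' == _]/(a' == a).
case: eqP => //= <-; rewrite eq_sym.
by rewrite /succ /rank (def_pblock tiA BA a'B) ra'.
Qed.

Lemma pblock_iter_pred x k : iter k pred_map x \in pblock A x.
Proof.
elim: k => [|k IHk] /=; first exact: mem_own_pblock.
case: (posnP (rank (iter k pred_map x))) => [/pred_map0->//|/pred_mapP[]].
by rewrite (pblock_eq IHk).
Qed.

Lemma rank_iter_pred x k : rank (iter k pred_map x) = rank x - k.
Proof.
elim: k => [|k IHk] /=; first by rewrite subn0.
case: (posnP (rank (iter k pred_map x))) => [r0|/pred_mapP[_ ]].
  by rewrite pred_map0 // r0 subnS -IHk r0.
by rewrite subnS -IHk => <-.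
Qed.

End SetPartition.

(** * The bijection between set partitions with a given word and valid predecessor maps *)

Section WordFiber.

Variables (n : nat) (alpha : seq nat) (w : 'I_n -> nat).
Hypothesis sum_alpha : sumn alpha = n.

Implicit Types (A : {set {set 'I_n}}) (f : {ffun 'I_n -> 'I_n}).

Definition cblock (x : 'I_n) : nat := reshape_index alpha x.

Lemma cblock_mono : {homo cblock : x y / x <= y}.
Proof.
by move=> x y; rewrite (reshape_leq alpha) /cblock; case: ltngtP.
Qed.

Lemma mem_canonical_block i (x : 'I_n) :
  i < size alpha -> (x \in canonical_block n alpha i) = (cblock x == i).
Proof.
move=> ialpha; rewrite inE.
have xa : x < sumn alpha by rewrite sum_alpha.
apply/idP/eqP => [/andP[ix xi]|<-].
  rewrite /cblock -(@flatten_indexKl alpha i (x - sumn (take i alpha))).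
    by rewrite /flatten_index subnKC.
  by rewrite ltn_subLR //; move: xi; rewrite (take_nth 0) // sumn_rcons.
have := reshape_indexP xa; rewrite -/(cblock x) => cx.
have := reshape_offsetP xa; rewrite /reshape_offset -/(cblock x) => ox.
have := reshape_indexK alpha x.
rewrite /flatten_index /reshape_offset -/(cblock x) => xE.
by rewrite (take_nth 0) // sumn_rcons; lia.
Qed.

Lemma same_canonical_blockE (x y : 'I_n) :
  same_canonical_block alpha (Some x) (Some y) = (cblock x == cblock y).
Proof.
apply/existsP/eqP => [[D /and3P[/imsetP[i _ ->]]]|e].
  by rewrite !mem_canonical_block // => /eqP-> /eqP->.
have xa : cblock x < size alpha by apply: reshape_indexP; rewrite sum_alpha.
exists (canonical_block n alpha (cblock x)).
rewrite !mem_canonical_block // e eqxx !andbT -e.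
by apply/imsetP; exists (Ordinal xa).
Qed.

Definition transversal_partition A : bool :=
  [forall x : 'I_n, forall y in pblock A x, (cblock x == cblock y) ==> (x == y)].

Lemma transversal_canonical A : partition A [set: 'I_n] ->
  [forall B in A, forall C in canonical n alpha, #|B :&: C| <= 1]
    = transversal_partition A.
Proof.
move=> partA; have tiA : trivIset A by case/and3P: partA.
apply/forall_inP/forallP => [H x|H B BA].
  apply/forall_inP => y yx; apply/implyP => /eqP e.
  have xa : cblock x < size alpha by apply: reshape_indexP; rewrite sum_alpha.
  have CC : canonical_block n alpha (cblock x) \in canonical n alpha.
    by apply/imsetP; exists (Ordinal xa).
  have /forall_inP/(_ _ CC)/card_le1_eqP := H _ (pblock_in partA x).
  move=> /(_ x y) -> //; rewrite inE ?yx ?mem_own_pblock //=.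
    by rewrite mem_canonical_block.
  by rewrite mem_canonical_block // e.
apply/forall_inP => C /imsetP[i _ ->]; apply/card_le1_eqP => x y.
rewrite inE mem_canonical_block // => /andP[xB /eqP cx].
rewrite inE mem_canonical_block // => /andP[yB /eqP cy].
have /forall_inP/(_ y) := H x; rewrite (def_pblock tiA BA xB) cx cy => /(_ yB).
by rewrite eqxx => /eqP.
Qed.

Definition has_word A : bool :=
  [&& partition A [set: 'I_n], transversal_partition A
    & [forall x, rank A x == w x]].

(** Following [f] from [x] as many times as its letter [w x] leads to an element that serves as the
    minimum of its block; the blocks are the fibres of this map. *)
Definition blocks_of f : {set {set 'I_n}} :=
  preim_partition (fun x => iter (w x) f x) [set: 'I_n].

(** In [A], iterating the predecessor [rank A x] times reaches the element of rank 0 in the block of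
    [x], and this element determines the block. *)
Lemma pred_mapK A : has_word A -> blocks_of (pred_map A) = A.
Proof.
case/and3P=> partA _ /forallP rk.
rewrite -[RHS](equivalence_partition_pblock partA).
rewrite /blocks_of /preim_partition /equivalence_partition.
apply: eq_imset => x; apply/setP => y; rewrite !inE /=.
have px := pblock_iter_pred partA x (w x); have py := pblock_iter_pred partA y (w y).
have r0 z : rank A (iter (w z) (pred_map A) z) = 0.
  by rewrite rank_iter_pred // -(eqP (rk z)) subnn.
apply/eqP/idP => [e|yx].
  by rewrite -(pblock_eq partA px) e (pblock_eq partA py) mem_own_pblock.
apply: (rank_inj partA); last by rewrite !r0.
by rewrite (pblock_eq partA py) (pblock_eq partA yx).
Qed.

Lemma valid_pred_map A : has_word A -> valid_upto cblock w n (pred_map A).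
Proof.
case/and3P=> partA /forallP trA /forallP rk; apply/forallP => x; rewrite ltn_ord.
rewrite /valid_at -(eqP (rk x)); case: posnP => [r0|r0].
  by rewrite pred_map0 // eqxx.
have [px rpx] := pred_mapP partA r0.
have ltpx : pred_map A x < x by rewrite -(rank_ltn partA px) -rpx.
rewrite inE -!(eqP (rk _)) rpx eqxx /=; apply/andP; split.
  rewrite ltn_neqAle cblock_mono ?andbT; last exact: ltnW.
  apply/eqP => e; have /forall_inP/(_ _ px) := trA x.
  by rewrite e eqxx => /eqP xE; move: ltpx; rewrite -xE ltnn.
apply/forallP => y; apply/implyP => /andP[yx]; rewrite -(eqP (rk y)) => ry0.
apply/eqP => e; have [py rpy] := pred_mapP partA ry0.
suff yxE : y = x by rewrite yxE ltnn in yx.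
apply: (rank_inj partA); last by rewrite -rpy e rpx.
by rewrite -(pblock_eq partA px) -e -pblock_sym.
Qed.

(** * From a valid map back to a set partition *)

Section OfMap.

Variable f : {ffun 'I_n -> 'I_n}.
Hypothesis validf : valid_upto cblock w n f.

Let f0 x : w x = 0 -> f x = x.
Proof.
by move=> wx; have /forallP/(_ x) := validf; rewrite ltn_ord /valid_at wx => /eqP.
Qed.

Let availf x : 0 < w x -> f x \in avail cblock w f x.
Proof.
by move=> wx; have /forallP/(_ x) := validf; rewrite ltn_ord /valid_at wx.
Qed.

Let wf x : 0 < w x -> (w (f x)).+1 = w x.
Proof. by move/availf; rewrite inE => /and3P[/eqP]. Qed.

Let cblockf x : 0 < w x -> cblock (f x) < cblock x.
Proof. by move/availf; rewrite inE => /and3P[]. Qed.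

Let ltf x : 0 < w x -> f x < x.
Proof.
move/cblockf; rewrite !ltnNge; apply: contra; exact: cblock_mono.
Qed.

Let lef k x : iter k f x <= x.
Proof.
elim: k => //= k IHk; apply: leq_trans IHk.
by case: (posnP (w (iter k f x))) => [/f0->//|/ltf/ltnW].
Qed.

Let f_inj x y : 0 < w x -> 0 < w y -> f x = f y -> x = y.
Proof.
move=> wx wy e; apply/val_inj; case: (ltngtP x y) => // lt.
  have := availf wy; rewrite inE => /and3P[_ _ /forallP/(_ x)].
  by rewrite lt wx e eqxx.
have := availf wx; rewrite inE => /and3P[_ _ /forallP/(_ y)].
by rewrite lt wy e eqxx.
Qed.

Let root x := iter (w x) f x.

Let wpred x : w (f x) = (w x).-1.
Proof. by case: (posnP (w x)) => [w0|/wf<-//]; rewrite f0 // w0. Qed.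

Let witer k x : w (iter k f x) = w x - k.
Proof. by elim: k => [|k IHk] /=; rewrite ?subn0 // wpred IHk subnS. Qed.

Let rootf x : root (f x) = root x.
Proof.
rewrite /root wpred; case wx: (w x) => [|k] /=; first by rewrite f0.
by rewrite -iterSr.
Qed.

(** Elements with a common root lie on a single chain of [f]. Since [f] is injective on elements
    with positive letter, the equality known for [f x] by induction lifts to [x]. *)
Let root_iter k x y :
  w x = k -> root x = root y -> k <= w y -> x = iter (w y - k) f y.
Proof.
elim: k x y => [|k IHk] x y wx e le.
  by rewrite subn0 -/(root y) -e /root wx.
apply: f_inj; rewrite ?witer ?subKn ?wx //.
have -> : f (iter (w y - k.+1) f y) = iter (w (f y) - k) f (f y).
  by rewrite -iterS -iterSr wpred; congr (iter _ f y); lia.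
by apply: IHk; rewrite ?wpred ?wx ?rootf //; lia.
Qed.

Lemma mem_pblock_blocks_of x y : (y \in pblock (blocks_of f) x) = (root x == root y).
Proof.
rewrite pblock_equivalence_partition ?inE // => a b c _ _ _.
by split=> // /eqP->.
Qed.

(** Induction on the letter: the elements of the block below [x] are [f x] and those below [f x], so
    the rank grows by one along with the letter. *)
Lemma rank_blocks_of x : rank (blocks_of f) x = w x.
Proof.
move: {2}(w x) (erefl (w x)) => k; elim: k x => [|k IHk] x wx; rewrite wx.
  apply/eqP; rewrite /rank cards_eq0; apply/eqP/setP => y; rewrite !inE.
  rewrite mem_pblock_blocks_of {1}/root wx /=; apply/negbTE/negP => /andP[/eqP->].
  by rewrite ltnNge lef.
have wx0 : 0 < w x by rewrite wx.
have rfx : rank (blocks_of f) (f x) = k by rewrite IHk wpred wx.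
rewrite -rfx /rank.
rewrite (cardsD1 (f x)) inE mem_pblock_blocks_of rootf eqxx ltf // add1n; congr _.+1.
apply: eq_card => y; rewrite !inE !mem_pblock_blocks_of rootf.
case: (root x =P root y) => [rxy|_]; rewrite ?andbF //= andbC.
apply/andP/idP => [[yx yfx]|yfx]; last first.
  split; first exact: ltn_trans yfx (ltf wx0).
  by apply/eqP => e; rewrite e ltnn in yfx.
rewrite ltn_neqAle; apply/andP; split=> //.
(* By [root_iter], either [x] is an iterate of [y], which contradicts [y < x], or [y] is a proper
   iterate of [x] and hence an iterate of [f x]. *)
case: (leqP (w x) (w y)) => wxy.
  have xE := root_iter erefl rxy wxy.
  by move: yx; rewrite xE ltnNge lef.
rewrite (root_iter erefl (esym rxy) (ltnW wxy)).
have -> : w x - w y = (w x - w y).-1.+1 by lia.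
by rewrite iterSr lef.
Qed.

(** Transversality holds because [cblock] strictly decreases at each proper step along a chain. *)
Lemma has_word_blocks_of : has_word (blocks_of f).
Proof.
have part : partition (blocks_of f) [set: 'I_n] by apply: preim_partitionP.
apply/and3P; split=> //; last by apply/forallP => x; rewrite rank_blocks_of.
suff H x y : root x = root y -> w x <= w y -> cblock x = cblock y -> x = y.
  apply/forallP => x; apply/forall_inP => y; rewrite mem_pblock_blocks_of.
  move=> /eqP rxy; apply/implyP => /eqP cxy; apply/eqP.
  by case/orP: (leq_total (w x) (w y)) => le; [|symmetry]; apply: H.
move=> rxy le cxy; have := root_iter erefl rxy le.
case d: (w y - w x) => [|k] // xE.
have wy0 : 0 < w y by move: d; lia.
have : cblock x < cblock y.
  by apply: leq_ltn_trans (cblockf wy0); apply: cblock_mono; rewrite xE iterSr lef.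
by rewrite cxy ltnn.
Qed.

Lemma blocks_ofK : pred_map (blocks_of f) = f.
Proof.
have /and3P[part _ _] := has_word_blocks_of; apply/ffunP => x.
case: (posnP (w x)) => wx; first by rewrite pred_map0 ?f0 ?rank_blocks_of.
have [|px rpx] := @pred_mapP _ _ part x; first by rewrite rank_blocks_of.
apply: (rank_inj part).
  by rewrite (pblock_eq part (x := x)) // mem_pblock_blocks_of rootf.
by apply: succn_inj; rewrite rpx !rank_blocks_of wf.
Qed.

End OfMap.

(** Interlacings are sorted by the right end [x] of their first arc. Its left end is then the
    predecessor of [x], and the second arc starts at a larger candidate [c]: the arc from [c] ends
    after [x] exactly when [c] has not been chosen by an earlier element, and different canonical
    blocks together with [c < x] give [cblock c < cblock x]. *)
Lemma num_interlacings_choice_rank A : has_word A ->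
  num_interlacings alpha A
    = \sum_(x | 0 < w x) choice_rank cblock w (pred_map A) x.
Proof.
move=> wA; have /and3P[partA trA /forallP rk] := wA.
have tiA : trivIset A by case/and3P: partA.
have /forallP validA := valid_pred_map wA.
pose f := pred_map A.
pose D := [set p : 'I_n * 'I_n | (0 < w p.1) && (p.2 \in avail cblock w f p.1)
                                 && (f p.1 < p.2)].
pose g (p : 'I_n * 'I_n) := ((f p.1, Some p.1), (p.2, succ A p.2)).
have wr x : w x = rank A x by rewrite (eqP (rk x)).
have availP x c : c \in avail cblock w f x ->
    [/\ (rank A c).+1 = rank A x, cblock c < cblock x
      & forall y, 0 < rank A y -> f y = c -> x <= y].
  rewrite inE !wr => /and3P[/eqP rc cbc /forallP H]; split=> // y ry fy.
  by rewrite leqNgt; apply/negP => yx; have := H y; rewrite wr yx ry fy eqxx.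
have ltn_cblock x y : cblock x < cblock y -> x < y.
  by rewrite !ltnNge; apply: contra; apply: cblock_mono.
have -> : num_interlacings alpha A = #|g @: D|.
  apply: eq_card => -[[a b] [c d]]; rewrite inE /=.
  apply/idP/imsetP => [/and5P[/existsP[B /andP[BA /existsP[C /andP[CA /existsP[j]]]]]]|].
    case/and3P=> _; rewrite !(arcsP partA) //= => /and3P[aB /eqP ra /eqP bE].
    move=> /and3P[cC /eqP rc /eqP dE] ac.
    (* The end [b] is finite, because [lt_infty] is false when its first argument is [None]. *)
    case: b bE => // x /esym/eqP; rewrite succ_pred // => /andP[rx /eqP fx] cx xd.
    rewrite same_canonical_blockE => cbxc; exists (x, c); last by rewrite /g fx dE.
    have [_ rfx] := pred_mapP partA rx.
    rewrite inE /= wr rx /f fx ac andbT inE !wr -rfx fx ra rc eqxx /=.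
    rewrite ltn_neqAle eq_sym cbxc cblock_mono ?(ltnW cx) //=.
    apply/forallP => y; rewrite wr; apply/implyP => /andP[yx ry]; apply/eqP => fy.
    have /eqP dy : succ A c == Some y by rewrite succ_pred // ry -fy eqxx.
    by move: xd; rewrite dE dy /= ltnNge ltnW.
  case=> -[x z]; rewrite inE /= => /andP[/andP[wx zav] fxz] [-> -> -> ->].
  have [rz cbz later] := availP x z zav.
  rewrite wr in wx; have [_ rfx] := pred_mapP partA wx.
  have fxrz : rank A (f x) = rank A z by apply: succn_inj; rewrite rfx rz.
  have sfx : succ A (f x) = Some x by apply/eqP; rewrite succ_pred // wx eqxx.
  (* Arc indices have type ['I_n]. The bound holds because [(rank A z).+1] is the rank of [x], the
     cardinal of a subset of ['I_n]. *)
  have rzn : rank A z < n.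
    by rewrite rz -[X in _ <= X]card_ord max_card.
  apply/and5P; split=> //.
  - apply/existsP; exists (pblock A (f x)); rewrite pblock_in //=.
    apply/existsP; exists (pblock A z); rewrite pblock_in //=.
    apply/existsP; exists (Ordinal rzn).
    rewrite !(arcsP partA) ?pblock_in //= !mem_own_pblock // fxrz sfx !eqxx !andbT.
    apply/eqP => e; have zfx : f x \in pblock A z by rewrite -e mem_own_pblock.
    by move: fxz; rewrite (rank_inj partA zfx fxrz) ltnn.
  - exact: ltn_cblock.
  (* If the second arc ends at a finite [d'], then [d'] has predecessor [z]. Availability of [z]
     gives [x <= d'], and equality would force [f x = z]. *)
  - case sz: (succ A z) => [d'|] //=.
    move/eqP: sz; rewrite succ_pred // => /andP[rd /eqP fd].
    rewrite ltn_neqAle later // andbT; apply/eqP => /val_inj xd.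
    by move: fxz; rewrite /f xd fd ltnn.
  - by rewrite same_canonical_blockE; apply/eqP => e; move: cbz; rewrite e ltnn.
rewrite card_imset; last by move=> [x c] [x' c'] [_ -> ->].
rewrite -sum1dep_card.
under [RHS]eq_bigr do rewrite /choice_rank -sum1dep_card.
rewrite pair_big_dep /=; apply: eq_bigl => -[x c] /=.
by rewrite andbA.
Qed.

Lemma sum_has_word :
  (\sum_(A | has_word A) 'X^(num_interlacings alpha A)
    = \prod_(x | (0 < w x)%N) qint (num_choices cblock w x))%R.
Proof.
transitivity (\sum_(A | has_word A)
    \prod_(x | (0 < w x)%N) ('X^(choice_rank cblock w (pred_map A) x) : {poly int}))%R.
  by apply: eq_bigr => A wA; rewrite num_interlacings_choice_rank // expr_sum.
rewrite (reindex_onto blocks_of (fun A => pred_map A)) /=; last by move=> A; apply: pred_mapK.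
have := sum_valid_upto w cblock_mono (leqnn n).
have ltn_ordE (F : 'I_n -> {poly int}) :
    (\prod_(x : 'I_n | (x < n)%N && (0 < w x)%N) F x = \prod_(x | (0 < w x)%N) F x)%R.
  by apply: eq_bigl => x; rewrite ltn_ord.
rewrite ltn_ordE => <-.
apply: eq_big => [f|f /andP[_ /eqP ->]]; last by rewrite ltn_ordE.
apply/andP/idP => [[wf /eqP <-]|vf]; first exact: valid_pred_map.
by rewrite has_word_blocks_of // blocks_ofK.
Qed.

End WordFiber.

(** * Shapes and letter counts *)

Lemma count_iota_card n (P : pred nat) : count P (iota 0 n) = #|[set x : 'I_n | P x]|.
Proof.
rewrite -val_enum_ord count_map -sum1_card -sum1_count big_enum_cond /=.
by apply: eq_bigl => x; rewrite inE.
Qed.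

Lemma count_mem_base_word b k :
  count_mem k (base_word b) = if k is l.+1 then nth 0 b l else 0.
Proof.
rewrite /base_word count_flatten -map_comp sumnE big_map.
under eq_bigr => i _ do rewrite /= count_nseq /=.
have -> : iota 0 (size b) = index_iota 0 (size b) by rewrite /index_iota subn0.
rewrite big_mkord.
case: k => [|l]; first by rewrite big1.
case: (ltnP l (size b)) => lb; last first.
  rewrite nth_default // big1 // => i _.
  by rewrite eqSS (ltn_eqF (leq_trans (ltn_ord i) lb)) mul0n.
rewrite (bigD1 (Ordinal lb)) //= eqxx mul1n big1 ?addn0 // => i.
by rewrite -val_eqE /= eqSS => /negbTE->; rewrite mul0n.
Qed.

Lemma size_base_word b : size (base_word b) = sumn b.
Proof.
rewrite /base_word size_flatten /shape -map_comp; congr sumn.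
rewrite -[RHS](mkseq_nth 0) /mkseq; apply: eq_map => i /=.
by rewrite size_nseq.
Qed.

Lemma perm_base_wordP (u b : seq nat) :
  reflect (0 \notin u /\ forall l, count_mem l.+1 u = nth 0 b l)
          (perm_eq u (base_word b)).
Proof.
apply: (iffP idP) => [pu|[u0 ul]].
  split=> [|l]; last by rewrite (permP pu) count_mem_base_word.
  by rewrite -has_pred1 has_count (permP pu) count_mem_base_word.
apply/allP => -[|l] _ /=; rewrite count_mem_base_word ?ul //.
by rewrite (count_memPn u0).
Qed.

(** Both sides say that the cell in row [l] and column [j] belongs to the Young diagram of [mu],
    seen by columns and by rows. *)
Lemma ltn_count_sorted mu l j :
  sorted geq mu -> (l < count (fun m => j < m) mu) = (j < nth 0 mu l).
Proof.
elim: mu l => [|m mu IHmu] l /=; first by rewrite nth_nil.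
move=> mmu; have smu := path_sorted mmu.
have le_m x : x \in mu -> x <= m.
  have geq_trans : transitive geq by move=> y x' z xy yz; exact: leq_trans yz xy.
  by move/allP: (order_path_min geq_trans mmu) => H /H.
case: (ltnP j m) => jm; first by case: l => [|l] //=; rewrite add1n ltnS IHmu.
have -> : count (fun x => j < x) mu = 0.
  apply/eqP; rewrite -leqn0 leqNgt -has_count; apply/hasPn => x /le_m xm.
  by rewrite -leqNgt (leq_trans xm).
case: l => [|l] /=; first by apply/esym/negbTE; rewrite -leqNgt.
apply/esym/negbTE; rewrite -leqNgt.
case: (ltnP l (size mu)) => lmu; last by rewrite nth_default.
by apply: leq_trans jm; rewrite le_m // mem_nth.
Qed.

Lemma nth_le_head mu l : sorted geq mu -> nth 0 mu l <= head 0 mu.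
Proof.
case: mu => [|m mu] smu; first by rewrite nth_nil.
rewrite leqNgt -ltn_count_sorted // -leqNgt.
have -> : count (fun x => head 0 (m :: mu) < x) (m :: mu) = 0; last by [].
by apply/eqP; rewrite -leqn0 leqNgt ltn_count_sorted // ltnn.
Qed.

Lemma count_ltn_conj_part mu l :
  sorted geq mu -> count (fun m => l < m) (conj_part mu) = nth 0 mu l.
Proof.
move=> smu; rewrite /conj_part count_map.
under eq_count => j do rewrite /= ltn_count_sorted //.
rewrite -size_filter.
have := filter_iota_ltn 0 (nth_le_head l smu).
by rewrite add0n => ->; rewrite size_iota.
Qed.

Lemma conj_part_sorted mu : sorted geq (conj_part mu).
Proof.
rewrite /conj_part sorted_map; apply: (sub_sorted _ (iota_sorted 0 _)) => i j /= ij.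
by apply: sub_count => m /=; apply: leq_ltn_trans.
Qed.

Lemma conj_part_gt0 mu : sorted geq mu -> 0 \notin conj_part mu.
Proof.
move=> smu; apply/mapP => -[j]; rewrite mem_iota add0n => /andP[_ jm] /esym/eqP.
by rewrite -leqn0 leqNgt ltn_count_sorted // nth0 jm.
Qed.

Lemma eq_sorted_geq (s t : seq nat) :
  sorted geq s -> sorted geq t -> 0 \notin s -> 0 \notin t ->
  (forall l, count (fun m => l < m) s = count (fun m => l < m) t) -> s = t.
Proof.
move=> ss st s0 t0 st_count; apply: (sorted_eq (leT := geq)) => //.
- by move=> y x z xy yz; exact: leq_trans yz xy.
- by move=> x y /andP[xy yx]; apply/eqP; rewrite eqn_leq; apply/andP.
apply/allP => -[|k] _ /=; first by rewrite (count_memPn s0) (count_memPn t0).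
(* Multiplicities are differences of consecutive tail counts, so the tail counts determine the
   multiset of parts. *)
have countS (u : seq nat) :
    count (fun m => k < m) u = count_mem k.+1 u + count (fun m => k.+1 < m) u.
  by elim: u => //= m u ->; case: ltngtP => //; lia.
by rewrite -(eqn_add2r (count (fun m => k.+1 < m) s)) -countS st_count countS st_count.
Qed.

(** * The shape of a set partition read off its word *)

Section Shape.

Variables (n : nat) (A : {set {set 'I_n}}).
Hypothesis partA : partition A [set: 'I_n].

Lemma word_ofE : word_of A = [seq (rank A x).+1 | x <- enum 'I_n].
Proof.
apply: eq_map => x; rewrite (cardsD1 x) inE mem_own_pblock // leqnn add1n.
by congr _.+1; apply: eq_card => y; rewrite !inE ltn_neqAle val_eqE andbCA.
Qed.

Lemma size_word_of : size (word_of A) = n.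
Proof. by rewrite size_map size_enum_ord. Qed.

Lemma nth_word_of (x : 'I_n) : nth 0 (word_of A) x = (rank A x).+1.
Proof.
by rewrite word_ofE (nth_map x) ?size_enum_ord // nth_ord_enum.
Qed.

Lemma count_word_of l : count_mem l.+1 (word_of A) = #|[set x | rank A x == l]|.
Proof.
rewrite word_ofE count_map -sum1_card -sum1_count big_enum_cond /=.
by apply: eq_bigl => x; rewrite inE.
Qed.

(** A block with more than [l] elements contains exactly one element of rank [l], and a smaller
    block contains none. *)
Lemma count_shape_of l :
  count (fun m => l < m) (shape_of A) = #|[set x | rank A x == l]|.
Proof.
rewrite /shape_of (permP (permEl (perm_sort _ _))) count_map.
have -> : #|[set x | rank A x == l]| = #|pblock A @: [set x | rank A x == l]|.
  rewrite card_in_imset // => x y; rewrite !inE => /eqP rx /eqP ry e.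
  by apply: (rank_inj partA); rewrite ?rx ?ry // -e mem_own_pblock.
rewrite -sum1_count big_enum_cond sum1dep_card; apply: eq_card => B; rewrite inE /=.
have tiA : trivIset A by case/and3P: partA.
apply/andP/imsetP => [[BA lB]|[x]].
  case e: (onth (enum B) l) => [x|]; last by move: lB; rewrite cardE -onthTE e.
  have /andP[xB /eqP rx] : (x \in B) && (#|[set y in B | y < x]| == l).
    by rewrite -onth_enum e.
  exists x; last by rewrite (def_pblock tiA BA xB).
  by rewrite inE /rank (def_pblock tiA BA xB) rx.
rewrite inE => /eqP <- ->; split; first exact: pblock_in.
apply/proper_card/properP; split; first by apply/subsetP => y; rewrite inE => /andP[].
by exists x; rewrite ?mem_own_pblock // inE ltnn andbF.
Qed.

Lemma shape_of_gt0 : 0 \notin shape_of A.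
Proof.
rewrite /shape_of mem_sort; apply/mapP => -[B]; rewrite mem_enum => BA /esym/eqP.
by rewrite cards_eq0 => /eqP B0; case/and3P: partA => _ _; rewrite -B0 BA.
Qed.

(** The multiplicity of the letter [l.+1] is the number of blocks of size greater than [l], so the
    content of the word is the conjugate of the shape. *)
Lemma shape_of_word_of mu : sorted geq mu ->
  (shape_of A == conj_part mu) = perm_eq (word_of A) (base_word mu).
Proof.
move=> smu; apply/eqP/perm_base_wordP => [e|[_ H]].
  split=> [|l]; first by rewrite word_ofE; apply/mapP => -[].
  by rewrite count_word_of -count_shape_of e count_ltn_conj_part.
apply: eq_sorted_geq.
- by apply: sort_sorted => x y; exact: leq_total.
- exact: conj_part_sorted.
- exact: shape_of_gt0.
- exact: conj_part_gt0.
by move=> l; rewrite count_shape_of -count_word_of H count_ltn_conj_part.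
Qed.

End Shape.

Lemma has_wordE n alpha mu (w : seq nat) (A : {set {set 'I_n}}) :
  sumn alpha = n -> sorted geq mu -> w \in permutations (base_word mu) -> size w = n ->
  (A \in set_partitions n (conj_part mu) alpha) && (word_of A == w)
    = has_word alpha (fun x => (nth 0 w x).-1) A.
Proof.
move=> sa smu; rewrite mem_permutations => pw sw.
have /perm_base_wordP[w0 _] := pw.
have wx_gt0 (x : 'I_n) : 0 < nth 0 w x.
  by rewrite lt0n; apply: contraNneq w0 => <-; rewrite mem_nth // sw.
rewrite inE /has_word; case partA: (partition A setT) => //=.
rewrite transversal_canonical // shape_of_word_of // andbC andbA.
have wordE : (forall x, rank A x == (nth 0 w x).-1) -> word_of A = w.
  move=> H; apply: (eq_from_nth (x0 := 0)); first by rewrite size_word_of.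
  rewrite size_word_of => i ilt; rewrite (nth_word_of partA (Ordinal ilt)) (eqP (H _)).
  exact: prednK (wx_gt0 (Ordinal ilt)).
have -> : (word_of A == w) = [forall x, rank A x == (nth 0 w x).-1].
  by apply/eqP/forallP => [<- x|/wordE //]; rewrite nth_word_of.
by case: forallP => H; rewrite ?andbF ?andbT // wordE // pw.
Qed.

(** * The tableau of a word *)

Lemma eq_cell mu (c d : cell mu) : row_of c = row_of d -> col_of c = col_of d -> c = d.
Proof.
case: c d => [i j] [i' j']; rewrite /row_of /col_of /= => /val_inj ii'.
by subst i' => /val_inj ->.
Qed.

Lemma row_lt_size mu (c : cell mu) : row_of c < size mu.
Proof. exact: ltn_ord. Qed.

Lemma col_lt_nth mu (c : cell mu) : col_of c < nth 0 mu (row_of c).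
Proof. exact: ltn_ord. Qed.

Lemma cell_at mu i j : j < nth 0 mu i -> exists c : cell mu, row_of c = i /\ col_of c = j.
Proof.
move=> ji; have imu : i < size mu.
  by rewrite ltnNge; apply/negP => le; rewrite nth_default in ji.
by exists (@Tagged _ (Ordinal imu) (fun i : 'I_(size mu) => 'I_(nth 0 mu i)) (Ordinal ji)).
Qed.

Lemma card_row_prefix mu i m : m <= nth 0 mu i ->
  #|[set c : cell mu | (row_of c == i) && (col_of c < m)]| = m.
Proof.
elim: m => [|m IHm] mi.
  by apply/eqP; rewrite cards_eq0; apply/eqP/setP => c; rewrite !inE andbF.
have [c [ci cm]] := cell_at mi.
rewrite (cardsD1 c) inE ci cm eqxx ltnSn add1n -[in RHS](IHm (ltnW mi)).
congr _.+1; apply: eq_card => d; rewrite !inE ltnS.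
case: (row_of d =P i) => di; rewrite ?andbF //=.
rewrite [in RHS]ltn_neqAle; congr (_ && _); congr negb.
by apply/eqP/eqP => [->//|dm]; apply: eq_cell; rewrite ?di ?ci ?cm.
Qed.

Lemma card_row mu i : #|[set c : cell mu | row_of c == i]| = nth 0 mu i.
Proof.
rewrite -[RHS](card_row_prefix (leqnn _)); apply: eq_card => c; rewrite !inE.
by case: eqP => //= <-; rewrite col_lt_nth.
Qed.

Lemma card_cell mu : #|cell mu| = sumn mu.
Proof.
rewrite card_tagged !sumnE big_map big_enum /= (big_nth 0) big_mkord.
by apply: eq_bigr => i _; rewrite card_ord.
Qed.

Lemma cell_above mu (c : cell mu) : sorted geq mu -> 0 < row_of c ->
  exists d : cell mu, (row_of d).+1 = row_of c /\ col_of d = col_of c.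
Proof.
move=> smu rc; have [|d [rd cd]] := @cell_at mu (row_of c).-1 (col_of c).
  apply: leq_trans (col_lt_nth c) _.
  have geq_trans : transitive geq by move=> y x z xy yz; exact: leq_trans yz xy.
  apply: (sorted_leq_nth geq_trans leqnn 0 smu); rewrite ?inE ?leq_pred //.
    by rewrite (leq_ltn_trans (leq_pred _)) // row_lt_size.
  by rewrite row_lt_size.
by exists d; rewrite rd prednK.
Qed.

Lemma filter_reshape_index alpha i : i < size alpha ->
  [seq x <- iota 0 (sumn alpha) | reshape_index alpha x == i]
    = iota (sumn (take i alpha)) (nth 0 alpha i).
Proof.
move=> ia; apply: (irr_sorted_eq ltn_trans ltnn).
- exact: (sorted_filter ltn_trans _ (iota_ltn_sorted _ _)).
- exact: iota_ltn_sorted.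
have tS : sumn (take i.+1 alpha) = sumn (take i alpha) + nth 0 alpha i.
  by rewrite (take_nth 0) // sumn_rcons.
have sa : sumn (take i.+1 alpha) <= sumn alpha.
  by rewrite -{2}(cat_take_drop i.+1 alpha) sumn_cat leq_addr.
move=> x; rewrite mem_filter !mem_iota add0n leq0n /= -tS.
case: (ltnP x (sumn alpha)) => xa; last first.
  rewrite andbF; apply/esym/negbTE.
  by rewrite negb_and -!ltnNge ltnS (leq_trans sa xa) orbT.
rewrite andbT.
rewrite -[reshape_index _ _]/(@cblock (sumn alpha) alpha (Ordinal xa)).
by rewrite -mem_canonical_block // inE.
Qed.

(** * Positions of a word as cells of the diagram *)

Section Standardization.

Variables (n : nat) (mu : seq nat) (W : 'I_n -> nat).
Hypothesis sum_mu : sumn mu = n.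
Hypothesis contentW : forall l, #|[set x | W x == l]| = nth 0 mu l.

Implicit Types (x y : 'I_n) (c d : cell mu).

Definition letter_rank x : nat := #|[set y : 'I_n | (y < x) && (W y == W x)]|.

Lemma letter_rank_lt x : letter_rank x < nth 0 mu (W x).
Proof.
rewrite -contentW; apply/proper_card/properP; split.
  by apply/subsetP => y; rewrite !inE => /andP[].
by exists x; rewrite !inE ?ltnn.
Qed.

Lemma letter_rank_ltn x y : W x = W y -> (letter_rank x < letter_rank y) = (x < y).
Proof.
have lt_rank u v : W u = W v -> u < v -> letter_rank u < letter_rank v.
  move=> Wuv lt; apply/proper_card/properP; split.
    by apply/subsetP => z; rewrite !inE Wuv => /andP[/ltn_trans-> //].
  by exists u; rewrite !inE ?ltnn // lt Wuv eqxx.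
move=> Wxy; case: (ltngtP x y) => [lt|lt|/val_inj->]; last by rewrite ltnn.
  exact: lt_rank.
by apply/negbTE; rewrite -leqNgt ltnW // lt_rank.
Qed.

Lemma letter_lt x : W x < size mu.
Proof.
by rewrite ltnNge; apply/negP => le; have := letter_rank_lt x; rewrite nth_default.
Qed.

(** The letter gives the row and the number of earlier occurrences of that letter gives the column.
    This is a bijection onto the cells, through which counts of cells become counts of positions. *)
Definition std x : cell mu :=
  @Tagged _ (Ordinal (letter_lt x)) (fun i : 'I_(size mu) => 'I_(nth 0 mu i))
    (Ordinal (letter_rank_lt x)).

Lemma row_std x : row_of (std x) = W x. Proof. by []. Qed.
Lemma col_std x : col_of (std x) = letter_rank x. Proof. by []. Qed.

Lemma std_inj : injective std.
Proof.
move=> x y e; have Wxy : W x = W y by rewrite -row_std e.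
apply/val_inj; case: (ltngtP x y) => //; rewrite -letter_rank_ltn //.
  by rewrite -!col_std e ltnn.
by rewrite -!col_std e ltnn.
Qed.

Lemma std_bij : bijective std.
Proof. by apply: inj_card_bij std_inj _; rewrite card_cell card_ord sum_mu. Qed.

Lemma std_surj c : exists x, c = std x.
Proof. by have [g gK kK] := std_bij; exists (g c); rewrite kK. Qed.

Lemma card_std (P : pred (cell mu)) : #|[set x | P (std x)]| = #|[set c | P c]|.
Proof.
rewrite -(on_card_preimset (f := std)); last exact: onW_bij std_bij.
by apply: eq_card => x; rewrite !inE.
Qed.

End Standardization.

Lemma card_cblock n alpha i : sumn alpha = n -> i < size alpha ->
  #|[set x : 'I_n | cblock alpha x == i]| = nth 0 alpha i.
Proof.
move=> <- ia; rewrite -(count_iota_card (sumn alpha) (fun x => reshape_index alpha x == i)).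
by rewrite -size_filter filter_reshape_index // size_iota.
Qed.

(** * The filling determined by a word *)

Section Fits.

Variables (n : nat) (mu alpha : seq nat).
Hypothesis smu : sorted geq mu.
Hypothesis sum_mu : sumn mu = n.
Hypothesis sum_alpha : sumn alpha = n.

Implicit Types (T : filling mu alpha) (W : 'I_n -> nat).

Notation cb := (@cblock n alpha).

(** The equation [T (std x) = cb x], written through coordinates because [std] requires a proof
    about the content of [W], while [fits] has to be a boolean predicate on every [W]. *)
Definition fits W T : bool :=
  [forall x, forall c, (row_of c == W x) && (col_of c == letter_rank W x)
     ==> (T c == cb x :> nat)].

Lemma fitsP W (contentW : forall l, #|[set x | W x == l]| = nth 0 mu l) T :
  reflect (forall x, T (std contentW x) = cb x :> nat) (fits W T).
Proof.
apply: (iffP forallP) => [H x|H x].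
  by apply/eqP; have /forallP/(_ (std contentW x)) := H x; rewrite !eqxx.
apply/forallP => c; apply/implyP => /andP[/eqP rc /eqP cc].
by rewrite -H; apply/eqP; congr (val (T _)); apply: eq_cell.
Qed.

Lemma fits_card W (contentW : forall l, #|[set x | W x == l]| = nth 0 mu l) T i j :
  fits W T -> row_count T i j = #|[set x | (cb x == i) && (W x == j)]|.
Proof.
move=> /(fitsP contentW) fT; rewrite /row_count -(card_std sum_mu contentW).
by apply: eq_card => x; rewrite !inE -fT.
Qed.

Lemma row_weak_card_le T c m :
  (forall c d : cell mu, row_of c = row_of d -> col_of c <= col_of d -> T c <= T d) ->
  (m < T c) -> #|[set d : cell mu | (row_of d == row_of c) && (T d <= m)]| <= col_of c.
Proof.
move=> wk mT; rewrite -[X in _ <= X](card_row_prefix (ltnW (col_lt_nth c))).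
apply/subset_leq_card/subsetP => d; rewrite !inE => /andP[/eqP dc dm].
rewrite dc eqxx ltnNge; apply/negP => le.
by have := wk c d (esym dc) le; rewrite leqNgt (leq_ltn_trans dm mT).
Qed.

(** A weakly increasing row is determined by its content, and the canonical block indices of the
    occurrences of a letter also increase weakly from left to right. *)
Lemma fits_of_card W (contentW : forall l, #|[set x | W x == l]| = nth 0 mu l) T :
  (forall c d : cell mu, row_of c = row_of d -> col_of c <= col_of d -> T c <= T d) ->
  (forall i j, row_count T i j = #|[set x | (cb x == i) && (W x == j)]|) ->
  fits W T.
Proof.
move=> wk H; apply/(fitsP contentW) => x; set c := std contentW x.
(* Summing the hypothesis over the entries up to [m] gives equal cumulative counts in each row. *)
have cum m j : #|[set d : cell mu | (row_of d == j) && (T d <= m)]| =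
    #|[set y : 'I_n | (W y == j) && (cb y <= m)]|.
  transitivity (\sum_(i < size alpha | i <= m) row_count T i j).
    rewrite -sum1_card (partition_big (fun d => T d) (fun i => i <= m)) /=.
      apply: eq_bigr => i im; rewrite sum1dep_card; apply: eq_card => d.
      rewrite !inE; case: (T d =P i) => [->|_]; rewrite ?im ?andbT ?andbF //.
    by move=> d; rewrite inE => /andP[].
  have cbP (y : 'I_n) : cb y < size alpha by apply: reshape_indexP; rewrite sum_alpha.
  rewrite -sum1_card (partition_big (fun y => Ordinal (cbP y)) (fun i => i <= m)) /=.
    apply: eq_bigr => i im; rewrite H sum1dep_card; apply: eq_card => y.
    rewrite !inE -val_eqE /=; case: (cb y =P i) => [->|_]; rewrite ?im ?andbT ?andbF //.
  by move=> d; rewrite inE => /andP[].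
(* If [T c < cb x], the [(col_of c).+1] cells of the row up to [c] have entries at most [T c], but
   only positions before [x] can account for them, and there are [col_of c] of these. *)
case: (ltngtP (T c) (cb x)) => // lt.
  have : #|[set d : cell mu | (row_of d == W x) && (col_of d < (col_of c).+1)]| <= letter_rank W x.
    apply: (@leq_trans #|[set d : cell mu | (row_of d == W x) && (T d <= T c)]|).
      apply/subset_leq_card/subsetP => d; rewrite !inE ltnS => /andP[/eqP dx dc].
      by rewrite dx eqxx wk.
    rewrite cum; apply/subset_leq_card/subsetP => y; rewrite !inE => /andP[-> cby].
    rewrite andbT ltnNge; apply/negP => xy; move: (leq_ltn_trans cby lt).
    by rewrite ltnNge cblock_mono.
  by rewrite card_row_prefix ?ltnn //; apply: (col_lt_nth c).
(* If [cb x < T c], then [x] and the [col_of c] earlier occurrences of its letter give one more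
   entry at most [cb x] than there are cells left of [c]. *)
have := row_weak_card_le wk lt; rewrite cum; rewrite leqNgt => /negP[].
apply/proper_card/properP; split.
  apply/subsetP => y; rewrite !inE => /andP[yx ->] /=.
  by apply: cblock_mono; apply: ltnW.
by exists x; rewrite !inE ?ltnn // eqxx leqnn.
Qed.

Lemma fits_inj W (contentW : forall l, #|[set x | W x == l]| = nth 0 mu l) T T' :
  fits W T -> fits W T' -> T = T'.
Proof.
move=> /(fitsP contentW) fT /(fitsP contentW) fT'; apply/ffunP => c.
have [x ->] := std_surj sum_mu contentW c.
by apply/val_inj; rewrite /= fT fT'.
Qed.

Lemma fits_exists W (contentW : forall l, #|[set x | W x == l]| = nth 0 mu l) :
  exists T, fits W T.
Proof.
have cbP (y : 'I_n) : cb y < size alpha by apply: reshape_indexP; rewrite sum_alpha.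
have [g gK kK] := std_bij sum_mu contentW.
exists [ffun c => Ordinal (cbP (g c))]; apply/(fitsP contentW) => x.
by rewrite ffunE gK.
Qed.

Lemma fits_row_weak W (contentW : forall l, #|[set x | W x == l]| = nth 0 mu l) T :
  fits W T ->
  forall c d : cell mu, row_of c = row_of d -> col_of c <= col_of d -> T c <= T d.
Proof.
move=> /(fitsP contentW) fT c d.
have [x ->] := std_surj sum_mu contentW c.
have [y ->] := std_surj sum_mu contentW d.
rewrite !fT !row_std !col_std => Wxy.
rewrite leqNgt letter_rank_ltn // -leqNgt; exact: cblock_mono.
Qed.

Definition column_strict T : bool :=
  [forall c : cell mu, forall d : cell mu,
     (col_of c == col_of d) && ((row_of c).+1 == row_of d) ==> (T c < T d)].

(** Weakly increasing rows come from the monotonicity of [cblock], and the content is [alpha]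
    because canonical block [i] has [nth 0 alpha i] elements; only the columns impose a
    condition. *)
Lemma fits_ssyt W (contentW : forall l, #|[set x | W x == l]| = nth 0 mu l) T :
  fits W T -> (T \in SSYT mu alpha) = column_strict T.
Proof.
move=> fT; have /(fitsP contentW) fT' := fT; rewrite inE /is_ssyt.
have -> : [forall c : cell mu, forall d : cell mu,
         (row_of c == row_of d) && (col_of c <= col_of d) ==> (T c <= T d)].
  apply/forallP => c; apply/forallP => d; apply/implyP => /andP[/eqP].
  exact: fits_row_weak fT c d.
have -> : [forall i : 'I_(size alpha), #|[set c | T c == i]| == nth 0 alpha i].
  apply/forallP => i; rewrite -(card_std sum_mu contentW) -(card_cblock sum_alpha (ltn_ord i)).
  by apply/eqP/eq_card => x; rewrite !inE -fT'.
rewrite andbT /=; apply/forallP/forallP => H c; apply/forallP => d; apply/implyP => /andP[cd].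
  by move/eqP => rcd; have /forallP/(_ d) := H c; rewrite cd -rcd ltnSn.
(* Strictness between adjacent rows propagates down a column, by induction on the distance between
   the rows. *)
move: {2}(row_of d - row_of c) (leqnn (row_of d - row_of c)) => k.
elim: k d cd => [|k IHk] d cd le lt; first by move: le lt; lia.
have [|u [ru cu]] := @cell_above mu d smu; first by apply: leq_ltn_trans lt.
have ud : T u < T d by have /forallP/(_ d) := H u; rewrite cu ru !eqxx.
case: (ltngtP (row_of c) (row_of u)) => [cru|cru|cru].
- by apply: ltn_trans ud; apply: IHk; rewrite ?cu //; lia.
- by move: lt; lia.
by rewrite (@eq_cell mu c u) // cu (eqP cd).
Qed.

(** At the cell [c] of [x], the number of choices is the number [Q c] of smaller entries in the row
    above, minus the column index. Under column-strictness the cells of that row to the left of [c]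
    all hold smaller entries, and removing them leaves [r_entry T c]. *)
Lemma prod_num_choices W (contentW : forall l, #|[set x | W x == l]| = nth 0 mu l) T :
  fits W T ->
  (\prod_(x | (0 < W x)%N) qint (num_choices cb W x)
    = if T \in SSYT mu alpha then r_weight T else 0)%R.
Proof.
move=> fT; have /(fitsP contentW) fT' := fT; have wk := fits_row_weak contentW fT.
pose Q (c : cell mu) :=
  #|[set d : cell mu | ((row_of d).+1 == row_of c) && (T d < T c)]| - col_of c.
have -> : (\prod_(x | (0 < W x)%N) qint (num_choices cb W x)
    = \prod_(c : cell mu | (0 < row_of c)%N) qint (Q c))%R.
  rewrite [RHS](reindex (std contentW)) /=; last exact: onW_bij (std_bij sum_mu contentW).
  apply: eq_bigr => x _; rewrite /num_choices /Q -(card_std sum_mu contentW).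
  congr (qint (_ - _)); apply: eq_card => y; rewrite !inE !fT' //.
rewrite (fits_ssyt contentW fT); case: ifP => [/forallP strT|].
  apply: eq_bigr => c c0; congr qint; rewrite /Q /r_entry.
  set X := [set d : cell mu | _]; set Y := [set d : cell mu | _].
  have [u [ru cu]] := cell_above smu c0.
  pose Z := [set d : cell mu | (row_of d == row_of u) && (col_of d < col_of c)].
  have ZE : #|Z| = col_of c by rewrite card_row_prefix // -cu ltnW // col_lt_nth.
  have ltZ d : d \in Z -> T d < T c.
    rewrite inE => /andP[/eqP du dc].
    apply: (@leq_ltn_trans (T u)); first by rewrite (wk d u du) // cu ltnW.
    by have /forallP/(_ c) := strT u; rewrite ru cu !eqxx.
  rewrite -(cardsID Z X) (setIidPr _) ?ZE ?addKn.
    apply: eq_card => d; rewrite !inE -[(row_of d).+1 == _]andbT -ru eqSS.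
    by case: eqP => //= du; rewrite -leqNgt.
  by apply/subsetP => d dZ; rewrite inE ltZ // andbT -ru eqSS; move: dZ; rewrite inE => /andP[].
move/negbT/forallPn => [d /forallPn [c]]; rewrite negb_imply => /andP[/andP[/eqP cd /eqP rd]].
rewrite -leqNgt => Tcd; rewrite (bigD1 c) /=; last by rewrite -rd.
(* At a violation of strictness the entry above [c] is at least [T c], so the smaller entries of
   that row lie strictly to the left of [c] and the truncated difference is 0. *)
suff -> : Q c = 0 by rewrite /qint big_ord0 mul0r.
apply/eqP; rewrite subn_eq0 -cd -[X in _ <= X](card_row_prefix (ltnW (col_lt_nth d))).
apply/subset_leq_card/subsetP => e; rewrite !inE -rd eqSS => /andP[/eqP ed ec].
rewrite ed eqxx ltnNge; apply/negP => le.
by move: ec; rewrite ltnNge (leq_trans Tcd) // (wk d e).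
Qed.

End Fits.

(** * Words with a given tableau *)

Lemma count_segment n alpha w i k : sumn alpha = n -> size w = n -> i < size alpha ->
  count_mem k (nth [::] (reshape alpha w) i)
    = #|[set x : 'I_n | (cblock alpha x == i) && (nth 0 w x == k)]|.
Proof.
move=> <- sw ia; rewrite nth_reshape.
have le : sumn (take i alpha) + nth 0 alpha i <= size w.
  by rewrite sw -sumn_rcons -take_nth // -{2}(cat_take_drop i.+1 alpha) sumn_cat leq_addr.
rewrite -(map_nth_iota 0) 1?leq_subRL // ?(leq_trans (leq_addr _ _) le) //.
rewrite count_map -filter_reshape_index // count_filter count_iota_card.
by apply: eq_card => x; rewrite !inE andbC.
Qed.

Definition concat_permutations (bs : seq (seq nat)) : seq (seq nat) :=
  foldr (fun b L => [seq u ++ v | u <- permutations (base_word b), v <- L]) [:: [::]] bs.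

Lemma mem_concat_permutations bs w :
  (w \in concat_permutations bs)
    = (size w == sumn [seq sumn b | b <- bs])
      && all2 (fun u b => perm_eq u (base_word b)) (reshape [seq sumn b | b <- bs] w) bs.
Proof.
elim: bs w => [|b bs IHbs] w /=; first by rewrite inE size_eq0 andbT.
apply/allpairsP/and3P => [[[u v] /= []]|[sw pu sv]].
  rewrite mem_permutations IHbs => pu /andP[/eqP sv av] ->.
  have su : size u = sumn b by rewrite (perm_size pu) size_base_word.
  by rewrite size_cat su sv take_size_cat ?drop_size_cat.
exists (take (sumn b) w, drop (sumn b) w); rewrite /= mem_permutations cat_take_drop IHbs.
by rewrite sv andbT size_drop (eqP sw) addKn.
Qed.

Lemma uniq_concat_permutations bs : uniq (concat_permutations bs).
Proof.
elim: bs => //= b bs IHbs; apply: allpairs_uniq => //; first exact: permutations_uniq.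
move=> _ _ /allpairsP[[u v] [/= + _ ->]] /allpairsP[[u' v'] [/= + _ ->]] /eqP /=.
rewrite !mem_permutations => /perm_size su /perm_size su'.
by rewrite eqseq_cat ?su ?su' // => /andP[/eqP-> /eqP->].
Qed.

(** The lengths of the factors are fixed by [bs], so cutting a concatenation recovers them and
    [stat_word] adds up their statistics. *)
Lemma prod_sum_permutations (R : nzSemiRingType) (phi : seq nat -> nat) bs :
  (\prod_(b <- bs) \sum_(u <- permutations (base_word b)) 'X^(phi u)
    = \sum_(w <- concat_permutations bs)
        'X^(stat_word [seq sumn b | b <- bs] phi w) :> {poly R})%R.
Proof.
elim: bs => [|b bs IHbs]; first by rewrite big_nil /= big_seq1 /stat_word big_nil.
rewrite big_cons IHbs big_distrl /= big_allpairs_dep /=.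
rewrite big_seq [RHS]big_seq; apply: eq_bigr => u; rewrite mem_permutations => pu.
rewrite big_distrr /=; apply: eq_bigr => v _; rewrite -exprD /stat_word.
have su : size u = sumn b by rewrite (perm_size pu) size_base_word.
by rewrite /= take_size_cat ?drop_size_cat // big_cons.
Qed.

Lemma all2_nthP (S T : Type) (r : S -> T -> bool) (s : seq S) (t : seq T) x0 y0 :
  size s = size t ->
  reflect (forall i, i < size t -> r (nth x0 s i) (nth y0 t i)) (all2 r s t).
Proof.
move=> st; rewrite all2E st eqxx /=.
apply: (iffP (all_nthP (x0, y0))) => H i; rewrite ?size_zip ?st ?minnn => it.
  by have := H i; rewrite size_zip st minnn nth_zip //= => /(_ it).
by rewrite nth_zip //=; exact: H.
Qed.

(** * Summation over all words of content [mu] *)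

Section Words.

Variables (n : nat) (mu alpha : seq nat).
Hypothesis hmu : is_partition_of n mu.
Hypothesis halpha : is_composition_of n alpha.

Let smu : sorted geq mu. Proof. by case/and3P: hmu. Qed.
Let sum_mu : sumn mu = n. Proof. by case/and3P: hmu => _ _ /eqP. Qed.
Let sum_alpha : sumn alpha = n. Proof. by case/andP: halpha => _ /eqP. Qed.

Implicit Types (T : filling mu alpha) (w : seq nat).

Definition letter w (x : 'I_n) : nat := (nth 0 w x).-1.

Lemma letter_eq w x l : 0 \notin w -> size w = n ->
  (letter w x == l) = (nth 0 w x == l.+1).
Proof.
move=> w0 sw; have : 0 < nth 0 w x.
  by rewrite lt0n; apply: contraNneq w0 => <-; rewrite mem_nth // sw.
by rewrite /letter; case: (nth 0 w x).
Qed.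

Lemma count_mem_letter w l : 0 \notin w -> size w = n ->
  count_mem l.+1 w = #|[set x | letter w x == l]|.
Proof.
move=> w0 sw; rewrite -{1}(mkseq_nth 0 w) count_map sw count_iota_card.
by apply: eq_card => x; rewrite !inE letter_eq.
Qed.

Lemma content_letter w : w \in permutations (base_word mu) ->
  forall l, #|[set x | letter w x == l]| = nth 0 mu l.
Proof.
rewrite mem_permutations => pw l; have /perm_base_wordP[w0 <-] := pw.
by rewrite count_mem_letter // (perm_size pw) size_base_word.
Qed.

Definition row_counts T (i : 'I_(size alpha)) : seq nat :=
  [seq row_count T i j | j <- iota 0 (size mu)].

Lemma nth_row_counts T i j : nth 0 (row_counts T i) j = row_count T i j.
Proof.
case: (ltnP j (size mu)) => jmu.
  by rewrite (nth_map 0) ?size_iota // nth_iota.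
rewrite nth_default ?size_map ?size_iota //; apply/esym/eqP.
rewrite cards_eq0; apply/eqP/setP => c; rewrite !inE.
by rewrite (ltn_eqF (leq_trans (row_lt_size c) jmu)) andbF.
Qed.

Lemma sumn_row_counts T i : T \in SSYT mu alpha -> sumn (row_counts T i) = nth 0 alpha i.
Proof.
rewrite inE => /and3P[_ _ /forallP/(_ i)/eqP <-].
rewrite sumnE big_map.
have -> : iota 0 (size mu) = index_iota 0 (size mu) by rewrite /index_iota subn0.
rewrite big_mkord -sum1_card (partition_big (fun c => tag c) predT) //=.
by apply: eq_bigr => j _; rewrite sum1dep_card; apply: eq_card => c; rewrite !inE.
Qed.

Lemma map_sumn_row_counts T : T \in SSYT mu alpha ->
  [seq sumn b | b <- [seq row_counts T i | i <- enum 'I_(size alpha)]] = alpha.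
Proof.
move=> ssT; rewrite -map_comp; apply: (eq_from_nth (x0 := 0)).
  by rewrite size_map size_enum_ord.
rewrite size_map size_enum_ord => i ia.
by rewrite (nth_map (Ordinal ia)) ?size_enum_ord //= (sumn_row_counts _ ssT) nth_enum_ord.
Qed.

(** The number of letters [l.+1] in segment [i] of [w] is matched with the number of entries [i] in
    row [l] of [T]. Since the rows of [T] increase weakly, these numbers determine it by
    [fits_of_card]. *)
Lemma concat_permutations_fits T w : T \in SSYT mu alpha ->
  (w \in concat_permutations [seq row_counts T i | i <- enum 'I_(size alpha)])
    = (w \in permutations (base_word mu)) && fits (letter w) T.
Proof.
move=> ssT; set bs := map _ _.
have sums : [seq sumn b | b <- bs] = alpha by exact: map_sumn_row_counts.
have sbs : size bs = size alpha by rewrite -sums size_map.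
have bsE (i : 'I_(size alpha)) : nth [::] bs i = row_counts T i.
  by rewrite (nth_map i) ?size_enum_ord // nth_ord_enum.
rewrite mem_concat_permutations sums mem_permutations.
have srs (v : seq nat) : size (reshape alpha v) = size bs by rewrite size_reshape.
case: eqP => sw /=; last first.
  apply/esym/negbTE; rewrite negb_and; apply/orP; left; apply/negP => /perm_size.
  by rewrite size_base_word sum_mu -sum_alpha.
have swn : size w = n by rewrite sw.
have seg0 i : 0 \notin w -> i < size alpha -> 0 \notin nth [::] (reshape alpha w) i.
  move=> w0 ia; rewrite nth_reshape; apply: contra w0.
  by move/mem_take/mem_drop.
have segS (i : 'I_(size alpha)) l : 0 \notin w ->
    count_mem l.+1 (nth [::] (reshape alpha w) i)
      = #|[set x : 'I_n | (cblock alpha x == i) && (letter w x == l)]|.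
  move=> w0; rewrite (count_segment _ sum_alpha) //.
  by apply: eq_card => x; rewrite !inE letter_eq.
apply/(all2_nthP _ [::] [::] (srs w))/andP => [H|[pw fT]].
  have segP (i : 'I_(size alpha)) :
      perm_eq (nth [::] (reshape alpha w) i) (base_word (row_counts T i)).
    by rewrite -bsE H // sbs.
  have w0 : 0 \notin w.
    apply/negP; rewrite -{1}(@reshapeKr _ alpha w) ?sw // => /flattenP[u].
    move=> /(nthP [::])[i]; rewrite size_reshape => ia <-.
    by have /perm_base_wordP[/negbTE->] := segP (Ordinal ia).
  have rcE (i : 'I_(size alpha)) l :
      row_count T i l = #|[set x : 'I_n | (cblock alpha x == i) && (letter w x == l)]|.
    by rewrite -segS // -nth_row_counts; have /perm_base_wordP[_ ->] := segP i.
  have cw l : #|[set x | letter w x == l]| = nth 0 mu l.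
    have cbP (y : 'I_n) : cblock alpha y < size alpha.
      by apply: reshape_indexP; rewrite sum_alpha.
    rewrite -card_row -sum1_card (partition_big (fun y => Ordinal (cbP y)) predT) //=.
    rewrite -[RHS]sum1_card [RHS](partition_big T predT) //=.
    apply: eq_bigr => i _; rewrite !sum1dep_card.
    transitivity (row_count T i l); [rewrite rcE|]; apply: eq_card => x;
      by rewrite !inE -?val_eqE andbC.
  split; first by apply/perm_base_wordP; split=> // l; rewrite count_mem_letter.
  apply: (fits_of_card sum_alpha cw) => //.
  move: ssT; rewrite inE => /and3P[/forallP wk _ _] c d rcd ccd.
  by have /forallP/(_ d) := wk c; rewrite rcd eqxx ccd.
move=> i; rewrite sbs => ia; rewrite (bsE (Ordinal ia)).
have /perm_base_wordP[w0 _] := pw.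
have cw := content_letter (w := w); rewrite mem_permutations in cw; have {}cw := cw pw.
apply/perm_base_wordP; split=> [|l]; first exact: seg0.
by rewrite (segS (Ordinal ia)) // nth_row_counts (fits_card sum_mu cw _ _ fT).
Qed.

(** The Mahonian property is applied in each canonical block [i] to the weak composition
    [row_counts T i], which may contain zeros. *)
Lemma s_weight_fits (phi : seq nat -> nat) T : mahonian phi -> T \in SSYT mu alpha ->
  (s_weight T = \sum_(w <- permutations (base_word mu) | fits (letter w) T)
                  'X^(stat_word alpha phi w))%R.
Proof.
move=> hphi ssT; pose bs := [seq row_counts T i | i <- enum 'I_(size alpha)].
have sums : [seq sumn b | b <- bs] = alpha by exact: map_sumn_row_counts.
transitivity (\prod_(b <- bs) \sum_(u <- permutations (base_word b)) 'X^(phi u) : {poly int})%R.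
  rewrite big_map big_enum; apply: eq_bigr => i _.
  by rewrite hphi (sumn_row_counts _ ssT).
rewrite prod_sum_permutations sums -[RHS]big_filter; apply: perm_big.
apply: uniq_perm; rewrite ?uniq_concat_permutations ?filter_uniq ?permutations_uniq //.
by move=> w; rewrite mem_filter concat_permutations_fits // andbC.
Qed.

Lemma sum_set_partitions_words (R : nmodType) (F : {set {set 'I_n}} -> R) :
  (\sum_(A in set_partitions n (conj_part mu) alpha) F A
    = \sum_(w <- permutations (base_word mu)) \sum_(A | has_word alpha (letter w) A) F A)%R.
Proof.
rewrite big_seq; under eq_bigr => w wL.
  have sw : size w = n.
    by move: wL; rewrite mem_permutations => /perm_size ->; rewrite size_base_word.
  under eq_bigl => A do rewrite -(has_wordE A sum_alpha smu wL sw).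
  over.
rewrite -big_seq (exchange_big_dep (mem (set_partitions n (conj_part mu) alpha))) /=; last first.
  by move=> w A _ /andP[].
apply: eq_bigr => A AP.
(* After the exchange of sums, [A] is counted only at its own word. *)
under eq_bigl => w do rewrite AP /= eq_sym.
rewrite -big_filter filter_pred1_uniq ?permutations_uniq ?big_seq1 // mem_permutations.
move: AP; rewrite inE => /and3P[partA shA _].
by rewrite -shape_of_word_of.
Qed.

(** Both sides become sums over words, with the power of [t] fixed by the word. It remains to
    compare, word by word, the r-weight of its tableau with the sum over the set partitions having
    that word. *)
Lemma b_tilde_sum_set_partitions (phi : seq nat -> nat) : mahonian phi ->
  (b_tilde mu alpha =
     \sum_(A in set_partitions n (conj_part mu) alpha)
        'X%:P ^+ num_interlacings alpha A * 'X^(stat alpha phi A))%R.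
Proof.
move=> hphi; rewrite sum_set_partitions_words.
transitivity (\sum_(w <- permutations (base_word mu))
    (\sum_(T in SSYT mu alpha | fits (letter w) T) r_weight T)%:P
      * 'X^(stat_word alpha phi w) : {poly {poly int}})%R.
  rewrite /b_tilde; under eq_bigr => T ssT.
    rewrite (s_weight_fits hphi ssT) rmorph_sum /= mulr_sumr.
    under eq_bigr do rewrite map_polyXn.
    over.
  rewrite (exchange_big_dep predT) //=; apply: eq_bigr => w _.
  by rewrite -big_distrl /= rmorph_sum.
rewrite big_seq [RHS]big_seq; apply: eq_bigr => w wL.
have cw := content_letter wL.
have sw : size w = n.
  by move: wL; rewrite mem_permutations => /perm_size ->; rewrite size_base_word.
have -> : (\sum_(T in SSYT mu alpha | fits (letter w) T) r_weight T =
    \sum_(A | has_word alpha (letter w) A) 'X^(num_interlacings alpha A))%R.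
  rewrite sum_has_word //.
  (* Exactly one filling fits the word; if it is not semistandard, the sum of r-weights is empty and
     the product of q-integers is 0. *)
  have [T fT] := fits_exists sum_mu sum_alpha cw.
  rewrite (prod_num_choices smu sum_mu sum_alpha cw fT) big_mkcond.
  rewrite (bigD1 T) //= fT andbT big1 ?addr0 // => T' T'T.
  case: andP => // -[_ fT']; case/eqP: T'T.
  by apply: (fits_inj sum_mu cw).
rewrite rmorph_sum big_distrl /=; apply: eq_bigr => A.
rewrite -(has_wordE A sum_alpha smu wL sw) => /andP[_ /eqP wA].
by rewrite rmorphXn /= /stat wA.
Qed.

End Words.

Theorem theorem3p9 (n : nat) (mu alpha : seq nat) (phi : seq nat -> nat)
    (hmu : is_partition_of n mu) (halpha : is_composition_of n alpha)
    (hphi : mahonian phi) :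
  (b_tilde mu alpha =
     \sum_(A in set_partitions n (conj_part mu) alpha)
        ('X%:P) ^+ num_interlacings alpha A * 'X^(stat alpha phi A))%R /\
  (b_poly mu alpha =
     \sum_(A in set_partitions n (conj_part mu) alpha)
        'X^(num_interlacings alpha A + stat alpha phi A))%R.
Proof.
have bE := b_tilde_sum_set_partitions hmu halpha hphi; split=> //.
rewrite /b_poly bE horner_sum; apply: eq_bigr => A _.
by rewrite -rmorphXn /= mul_polyC hornerZ hornerXn exprD.
Qed.
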